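(* Suppose that $\mathcal Z$ consists of independent (mean-zero) Gaussian entries of variance lower bounded by $\sigma_{\min}^2$, and suppose that $\kappa^2\mu_0\sqrt{r/p}\ll1$. Then for any unbiased estimator $\check{\mathcal T}_{ijk}$ of $\mathcal T_{ijk}$ (based on the observation $\widetilde{\mathcal T}=\mathcal T+\mathcal Z$) it holds that $$\mathrm{Var}(\check{\mathcal T}_{ijk})\ge(1-o(1))\,\sigma_{\min}^2\Big(\|e_{(j-1)p_3+k}^\top\mathbf V_1\|^2+\|e_{(k-1)p_1+i}^\top\mathbf V_2\|^2+\|e_{(i-1)p_2+j}^\top\mathbf V_3\|^2\Big).$$
   Context: Notation. $a\lesssim b$ means $a\le Cb$ for a universal constant $C>0$; $a\asymp b$ means $a\lesssim b\lesssim a$; $a\ll b$ (also $a=o(b)$) means $a/b\to0$. Asymptotics are as $p\to\infty$. $\|\mathbf M\|$ is the spectral norm (Euclidean norm for vectors), $\|\mathbf M\|_{2,\infty}=\max_i\|\mathbf M_{i\cdot}\|$; $e_m$ are standard basis vectors. $\mathrm{SVD}_r(\mathbf M)$ is the matrix of leading $r$ left singular vectors. Mode indices are understood modulo 3. The mode-$k$ matricization $\mathcal M_k(\mathcal T)$ of $\mathcal T\in\mathbb R^{p_1\times p_2\times p_3}$ has $\mathcal T_{i_1i_2i_3}$ in row $i_k$ and column $(i_{k+1}-1)p_{k+2}+i_{k+2}$; $\times_k$ is the mode-$k$ product. Model. One observes $\widetilde{\mathcal T}=\mathcal T+\mathcal Z\in\mathbb R^{p_1\times p_2\times p_3}$,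 with $\mathcal Z$ having independent mean-zero entries of variance $\sigma_{ijk}^2$, $\sigma_{\min}\le\sigma_{ijk}\le\sigma\le C\sigma_{\min}$. Also $p_k\asymp p$, $r_k\asymp r$ for all $k$. The signal has Tucker rank $(r_1,r_2,r_3)$: $\mathcal T=\mathcal C\times_1\mathbf U_1\times_2\mathbf U_2\times_3\mathbf U_3$ with $\mathcal C\in\mathbb R^{r_1\times r_2\times r_3}$, $\mathbf U_k=\mathrm{SVD}_{r_k}(\mathcal M_k(\mathcal T))$, and rank-$r_k$ SVD $\mathcal M_k(\mathcal T)=\mathbf U_k\mathbf\Lambda_k\mathbf V_k^\top$. $\kappa=\max_k\|\mathcal M_k(\mathcal T)\|/\lambda_{r_k}(\mathcal M_k(\mathcal T))$ with $\lambda_{r_k}$ the $r_k$-th singular value; $\mu_0$ is the smallest number with $\max_k\sqrt{p_k/r_k}\,\|\mathbf U_k\|_{2,\infty}\le\mu_0$. *)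

(* Defs.v *)
From HB Require Import structures.
From mathcomp Require Export all_boot all_order all_algebra.
From mathcomp Require Export all_classical all_reals all_analysis.
Export Order.TTheory GRing.Theory Num.Theory.
Export numFieldNormedType.Exports.

Set Implicit Arguments.
Unset Strict Implicit.
Unset Printing Implicit Defensive.

#[global] Open Scope classical_set_scope.
#[global] Open Scope ring_scope.

Definition lesssim (R : realType) (a b : nat -> R) : Prop :=
  exists2 C : R, 0 < C & forall n, a n <= C * b n.

Definition asymp (R : realType) (a b : nat -> R) : Prop :=
  lesssim a b /\ lesssim b a.

Definition much_less (R : realType) (a b : nat -> R) : Prop :=
  (fun n => a n / b n) @ \oo --> (0 : R).

(* Meant for row and column vectors only. *)
Definition norm2 (R : realType) (m n : nat) (A : 'M[R]_(m, n)) : R :=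
  Num.sqrt (\sum_i \sum_j A i j ^+ 2).

Definition spectral_norm (R : realType) (m n : nat) (A : 'M[R]_(m, n)) : R :=
  sup [set norm2 (A *m x) | x in [set x : 'cV[R]_n | norm2 x <= 1]].

Definition norm2oo (R : realType) (m n : nat) (A : 'M[R]_(m, n)) : R :=
  \big[Num.max/0]_(i < m) norm2 (row i A).

(* The compact form, with exactly [r] positive singular values: its existence
   forces [\rank M = r]. *)
Record rank_svd (R : realType) (m n : nat) (M : 'M[R]_(m, n)) (r : nat) := {
  svd_left : 'M[R]_(m, r) ;
  svd_values : 'rV[R]_r ;
  svd_right : 'M[R]_(n, r) ;
  svd_leftP : svd_left^T *m svd_left = 1%:M ;
  svd_rightP : svd_right^T *m svd_right = 1%:M ;
  svd_values_gt0 : forall a, 0 < svd_values 0 a ;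
  svd_values_sorted : forall a b : 'I_r,
    (a <= b)%N -> svd_values 0 b <= svd_values 0 a ;
  svdE : M = svd_left *m diag_mx svd_values *m svd_right^T }.

Definition last_singular_value (R : realType) (m n : nat) (M : 'M[R]_(m, n))
    (r : nat) (S : rank_svd M r) : R :=
  last 0 [seq svd_values S 0 a | a <- enum 'I_r].

Definition tensor (R : realType) (p1 p2 p3 : nat) : Type :=
  'I_p1 -> 'I_p2 -> 'I_p3 -> R.

Local Lemma index_pairs (T1 T2 : eqType) (s : seq T1) (t : seq T2) x y :
  x \in s -> y \in t ->
  index (x, y) [seq (a, b) | a <- s, b <- t] = (index x s * size t + index y t)%N.
Proof.
move=> xs yt; elim: s xs => //= a s IHs; rewrite index_cat size_map inE eq_sym.
have [<- _|nax /= xs] := eqVneq a x.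
  by rewrite map_f// index_map // => u v [].
rewrite ifF ?IHs ?mulSn ?addnA //.
by apply/mapP=> -[b _ [/esym/eqP]]; rewrite (negPf nax).
Qed.

Lemma val_mxvec_index (m n : nat) (i : 'I_m) (j : 'I_n) :
  val (mxvec_index i j) = (i * n + j)%N.
Proof.
rewrite /= /enum_rank [enum_rank_in]unlock insubdK; last first.
  by rewrite -[_ \in _]/(_ < _)%N cardE index_mem mem_enum.
by rewrite enumT unlock /= index_pairs ?mem_enum // size_enum_ord !index_enum_ord.
Qed.

(* [mxvec] and [mxvec_index] are row-major; [val_mxvec_index] gives the
   explicit column index, with all indices counted from 0. *)
Definition unfold1 (R : realType) (p1 p2 p3 : nat) (T : tensor R p1 p2 p3) :
    'M[R]_(p1, p2 * p3) :=
  \matrix_(i < p1) mxvec (\matrix_(j < p2, k < p3) T i j k).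

Definition unfold2 (R : realType) (p1 p2 p3 : nat) (T : tensor R p1 p2 p3) :
    'M[R]_(p2, p3 * p1) :=
  \matrix_(j < p2) mxvec (\matrix_(k < p3, i < p1) T i j k).

Definition unfold3 (R : realType) (p1 p2 p3 : nat) (T : tensor R p1 p2 p3) :
    'M[R]_(p3, p1 * p2) :=
  \matrix_(k < p3) mxvec (\matrix_(i < p1, j < p2) T i j k).

Definition mode1_prod (R : realType) (q p1 p2 p3 : nat)
    (T : tensor R p1 p2 p3) (U : 'M[R]_(q, p1)) : tensor R q p2 p3 :=
  fun i j k => \sum_a U i a * T a j k.

Definition mode2_prod (R : realType) (q p1 p2 p3 : nat)
    (T : tensor R p1 p2 p3) (U : 'M[R]_(q, p2)) : tensor R p1 q p3 :=
  fun i j k => \sum_a U j a * T i a k.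

Definition mode3_prod (R : realType) (q p1 p2 p3 : nat)
    (T : tensor R p1 p2 p3) (U : 'M[R]_(q, p3)) : tensor R p1 p2 q :=
  fun i j k => \sum_a U k a * T i j a.

Definition has_tucker_rank (R : realType) (p1 p2 p3 : nat) (r1 r2 r3 : nat)
    (T : tensor R p1 p2 p3) : Prop :=
  [/\ \rank (unfold1 T) = r1, \rank (unfold2 T) = r2 & \rank (unfold3 T) = r3].

Record signal (R : realType) (p1 p2 p3 r1 r2 r3 : nat) := {
  sig_tensor :> tensor R p1 p2 p3 ;
  sig_core : tensor R r1 r2 r3 ;
  sig_svd1 : rank_svd (unfold1 sig_tensor) r1 ;
  sig_svd2 : rank_svd (unfold2 sig_tensor) r2 ;
  sig_svd3 : rank_svd (unfold3 sig_tensor) r3 ;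
  sig_rank : has_tucker_rank r1 r2 r3 sig_tensor ;
  sig_tucker : sig_tensor =
    mode3_prod (mode2_prod (mode1_prod sig_core
      (svd_left sig_svd1)) (svd_left sig_svd2)) (svd_left sig_svd3) }.

Section signal_parameters.
Context (R : realType) (p1 p2 p3 r1 r2 r3 : nat).
Variable S : signal R p1 p2 p3 r1 r2 r3.

Definition sig_V1 : 'M[R]_(p2 * p3, r1) := svd_right (sig_svd1 S).
Definition sig_V2 : 'M[R]_(p3 * p1, r2) := svd_right (sig_svd2 S).
Definition sig_V3 : 'M[R]_(p1 * p2, r3) := svd_right (sig_svd3 S).

Definition condition_number : R :=
  Num.max (spectral_norm (unfold1 S) / last_singular_value (sig_svd1 S))
  (Num.max (spectral_norm (unfold2 S) / last_singular_value (sig_svd2 S))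
           (spectral_norm (unfold3 S) / last_singular_value (sig_svd3 S))).

Definition incoherence : R :=
  Num.max (Num.sqrt (p1%:R / r1%:R) * norm2oo (svd_left (sig_svd1 S)))
  (Num.max (Num.sqrt (p2%:R / r2%:R) * norm2oo (svd_left (sig_svd2 S)))
           (Num.sqrt (p3%:R / r3%:R) * norm2oo (svd_left (sig_svd3 S)))).

End signal_parameters.

Definition mutually_independent (d : measure_display) (Omega : measurableType d)
    (R : realType) (P : probability Omega R) (I : finType)
    (X : I -> {RV P >-> R}) : Prop :=
  forall (J : {set I}) (A : I -> set R),
    (forall i, measurable (A i)) ->
    P (\bigcap_(i in [set` J]) (X i @^-1` A i)) =
    (\prod_(i in J) P (X i @^-1` A i))%E.

Section observation.
Context (d : measure_display) (Omega : measurableType d) (R : realType).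
Variables (P : probability Omega R) (p1 p2 p3 : nat).

Definition gaussian_noise (sd : tensor R p1 p2 p3)
    (Z : 'I_p1 -> 'I_p2 -> 'I_p3 -> {RV P >-> R}) : Prop :=
  (forall i j k (A : set R), measurable A ->
     distribution P (Z i j k) A = normal_prob 0 (sd i j k) A) /\
  mutually_independent
    (fun t : 'I_p1 * 'I_p2 * 'I_p3 => Z t.1.1 t.1.2 t.2).

Definition observed (Z : 'I_p1 -> 'I_p2 -> 'I_p3 -> {RV P >-> R})
    (T : tensor R p1 p2 p3) (w : Omega) : tensor R p1 p2 p3 :=
  fun i j k => T i j k + Z i j k w.

(* The Borel sigma-algebra of the space of tensors is generated by these. *)
Definition entry_cylinders : set (set (tensor R p1 p2 p3)) :=
  [set A | exists i j k (B : set R), measurable B /\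
     A = [set X : tensor R p1 p2 p3 | B (X i j k)]].

Definition estimator (delta : tensor R p1 p2 p3 -> R) : Prop :=
  forall B : set R, measurable B -> <<s entry_cylinders >> (delta @^-1` B).

(* Equality of the expectation with a real number implies integrability, since
   the integral is infinite for a measurable non-integrable function. *)
Definition unbiased (r1 r2 r3 : nat)
    (Z : 'I_p1 -> 'I_p2 -> 'I_p3 -> {RV P >-> R})
    (i : 'I_p1) (j : 'I_p2) (k : 'I_p3)
    (delta : tensor R p1 p2 p3 -> R) : Prop :=
  forall T : tensor R p1 p2 p3, has_tucker_rank r1 r2 r3 T ->
    ('E_P[fun w => delta (observed Z T w)] = (T i j k)%:E)%E.

End observation.

(* Main.v *)
From HB Require Import structures.
Require Import Defs.
From mathcomp Require Import measurable_realfun ring lra.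
Set Implicit Arguments.
Unset Strict Implicit.
Unset Printing Implicit Defensive.

(** The bound is a Cramer-Rao inequality along one well chosen curve of
    tensors of the same Tucker rank.

    Statistics.  Write [T] for the signal, [c] for a shift of it, [s] for the
    standard deviations of the noise, and [L] for the likelihood ratio of the
    model at [T + c] against the model at [T].  If [f] has means [m] and [m']
    in these two models, integrating [0 <= (f - m - t (L - 1)) ^ 2] gives, for
    every real [t], the Chapman-Robbins inequality
    [2 t (m' - m) <= Var f + t ^ 2 (E L ^ 2 - 1)]  ([chapman_robbins]), and for
    Gaussian noise [E L ^ 2 = exp (sum (c / s) ^ 2)] ([integral_lr_sqr]).
    Along a curve [c = h D + O(h ^ 2)] on which [f] is unbiased, replacing [t]
    by [t / h] and letting [h] tend to 0 turns this into
    [2 t D_ijk - t ^ 2 sum (D / s) ^ 2 <= Var f] ([cramer_rao_curve]).  Working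
    with differences in [h] instead of scores avoids any differentiation under
    the integral.  The formula [E f(X + c) = E (f(X) L)] behind it
    ([cameron_martin]) is proved one coordinate at a time: independence gives
    it for boxes, and boxes determine the law.

    Geometry.  The best direction is the projection of the coordinate tensor at
    [(i, j, k)] on the tangent space of the tensors of this Tucker rank.  Here
    [D] is the part of it that moves the singular subspaces,
    [D = D_1 + D_2 + D_3], where the unfolding of [D_1] is
    [((I - U_1 U_1^T) e_i) (e_jk^T V_1 V_1^T)] and likewise for the other
    modes.  These three tensors are pairwise orthogonal, and both the entry of
    [D] at [(i, j, k)] and its squared norm are
    [g = sum_l (1 - |row of U_l| ^ 2) |row of V_l| ^ 2].  Moreover [D_l] is the
    mode product of [T] with a matrix [A_l] of square zero.  Multiplying [T] in
    each mode by the invertible matrix [I + h A_l] therefore keeps the Tucker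
    rank for every [h], and has derivative [D] at 0 ([tangent_curve]).  With
    [t = sigma_min ^ 2] the bound reads [sigma_min ^ 2 g <= Var f].

    Asymptotics.  The leverages [|row of U_l| ^ 2] are at most
    [mu_0 ^ 2 r_l / p_l] ([leverage_le]); since the condition number is at
    least 1 ([condition_number_ge1]), this is at most a constant times the
    square of the quantity that is assumed to tend to 0. *)

(** * Integration against a measure given by a density *)

Section density_transfer.
Local Open Scope ereal_scope.
Context d1 d2 (X : measurableType d1) (Y : measurableType d2) (R : realType).
Variables (mu : {measure set X -> \bar R}) (nu : {measure set Y -> \bar R}).
Variables (phi : X -> Y) (g : X -> R).
Hypotheses (mphi : measurable_fun setT phi) (mg : measurable_fun setT g).
Hypothesis g_ge0 : forall x, (0 <= g x)%R.
Hypothesis nuE : forall B, measurable B ->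
  nu B = \int[mu]_(x in phi @^-1` B) (g x)%:E.

Import HBNNSimple.

(** One statement serves for densities ([phi] the identity), restrictions to an
    event ([g] an indicator) and reweighted laws of a random element.  It holds
    for indicators by assumption, hence for simple functions, hence by monotone
    convergence. *)
Lemma ge0_integral_density (f : Y -> \bar R) :
  measurable_fun setT f -> (forall y, 0 <= f y) ->
  \int[nu]_y f y = \int[mu]_x (f (phi x) * (g x)%:E).
Proof.
move=> mf f0; pose f_ := nnsfun_approx measurableT mf.
have f_cvg y : (EFin \o f_^~ y) @ \oo --> f y by exact: cvg_nnsfun_approx.
have f_nd y : nondecreasing_seq (fun n => (f_ n y)%:E).
  by move=> m n mn; rewrite lee_fin; exact/lefP/nd_nnsfun_approx.
have mgE : measurable_fun setT (fun x => (g x)%:E) by exact/measurable_EFinP.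
have mf_ n : measurable_fun [set: X] (fun x => (f_ n (phi x))%:E).
  apply/measurable_EFinP; apply: (measurableT_comp _ mphi).
  exact: measurable_funP.
transitivity (limn (fun n => \int[nu]_y (f_ n y)%:E)).
  rewrite -monotone_convergence//.
  - apply: eq_integral => y _; apply/esym/cvg_lim => //; exact: f_cvg.
  - by move=> n; exact/measurable_EFinP/measurable_funP.
  - by move=> n y _; rewrite lee_fin.
transitivity (limn (fun n =>
    \int[mu]_x ((f_ n (phi x))%:E * (g x)%:E))); last first.
  rewrite -monotone_convergence//.
  - apply: eq_integral => x _; apply/cvg_lim => //; apply: cvgeZr => //.
    exact: f_cvg.
  - by move=> n; exact: emeasurable_funM.
  - by move=> n x _; rewrite mule_ge0// lee_fin.
  - by move=> x _ m n mn; rewrite lee_wpmul2r ?lee_fin//; exact: f_nd.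
congr (limn _); apply/funext => n.
under eq_integral do rewrite fimfunE -fsumEFin//.
rewrite ge0_integral_fsum//; last 2 first.
- by move=> r; exact/measurable_EFinP/measurable_funM.
- by move=> r y _; exact: nnfun_muleindic_ge0.
transitivity (\int[mu]_x (\sum_(r \in range (f_ n))
    ((r * \1_(f_ n @^-1` [set r]) (phi x))%:E * (g x)%:E))); last first.
  apply: eq_integral => x _; rewrite -ge0_mule_fsuml; last first.
    by move=> r; exact: nnfun_muleindic_ge0.
  by rewrite fsumEFin// -fimfunE.
have mr r : measurable (phi @^-1` (f_ n @^-1` [set r])).
  by rewrite -[X in measurable X]setTI; exact: mphi.
have mind r : measurable_fun setT
    (fun x => (\1_(f_ n @^-1` [set r]) (phi x))%:E : \bar R).
  by apply/measurable_EFinP; exact: (measurable_indic (mr r)).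
rewrite ge0_integral_fsum//; last 2 first.
- move=> r; apply: emeasurable_funM => //.
  by under eq_fun do rewrite EFinM; exact: emeasurable_funM.
- move=> r x _; apply: mule_ge0; last by rewrite lee_fin.
  exact: nnfun_muleindic_ge0.
apply: eq_fsbigr => r /[1!inE] -[y _ <-].
have mAY : measurable (f_ n @^-1` [set f_ n y]) by [].
set A := f_ n @^-1` _ in mAY *.
under eq_integral do rewrite EFinM.
under [RHS]eq_integral do rewrite EFinM -muleA.
have mA : measurable_fun setT (fun x => (\1_A (phi x))%:E : \bar R).
  exact: mind.
have mA1 : measurable_fun setT (fun y => (\1_A y)%:E : \bar R).
  by apply/measurable_EFinP; exact: measurable_indic.
have fy0 : 0 <= (f_ n y)%:E by rewrite lee_fin.
have A0 x : 0 <= (\1_A (phi x))%:E * (g x)%:E.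
  by apply: mule_ge0; rewrite lee_fin.
have mAg : measurable_fun setT (fun x => (\1_A (phi x))%:E * (g x)%:E).
  exact: emeasurable_funM.
rewrite !ge0_integralZl//.
congr (_ * _); rewrite integral_indic// setIT nuE//.
rewrite (integral_mkcond (phi @^-1` A)); apply: eq_integral => x _.
rewrite patchE /indic /=.
rewrite [x \in _](_ : _ = (phi x \in A)); last by apply/idP/idP; rewrite !inE.
by case: ifP => _ /=; rewrite ?mul1e ?mul0e.
Qed.

End density_transfer.

Section density_measure.
Local Open Scope ereal_scope.
Context d1 d2 (X : measurableType d1) (Y : measurableType d2) (R : realType).
Variables (mu : {measure set X -> \bar R}) (phi : X -> Y) (g : X -> R).
Hypotheses (mphi : measurable_fun setT phi) (mg : measurable_fun setT g).
Hypothesis g_ge0 : forall x, (0 <= g x)%R.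

(** Uniqueness of measures on a generating pi-system compares bundled measures,
    so the reweighted law has to be one. *)
Lemma density_measure : exists nu : {measure set Y -> \bar R},
  forall B, nu B = \int[mu]_(x in phi @^-1` B) (g x)%:E.
Proof.
pose nu B := \int[mu]_(x in phi @^-1` B) (g x)%:E.
have nu0 : nu set0 = 0 by rewrite /nu preimage_set0 integral_set0.
have nu_ge0 B : 0 <= nu B by apply: integral_ge0 => x _; rewrite lee_fin.
have nu_sigma : semi_sigma_additive nu.
  move=> F mF tF mUF; rewrite /nu preimage_bigcup ge0_integral_bigcup//.
  - by apply: is_cvg_ereal_nneg_natsum_cond => n _ _; exact: nu_ge0.
  - by move=> n; rewrite -[X in measurable X]setTI; exact: mphi.
  - apply/measurable_funTS/measurable_EFinP; exact: mg.
  - by move=> x _; rewrite lee_fin.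
  - apply/trivIsetP => i j _ _ ij; rewrite -preimage_setI.
    by move/trivIsetP : tF => ->//; rewrite preimage_set0.
pose nu_mixin := isMeasure.Build _ _ _ nu nu0 nu_ge0 nu_sigma.
by exists (HB.pack_for {measure set Y -> \bar R} nu nu_mixin).
Qed.

End density_measure.

(** * Translating Gaussian variables *)

Section gaussian_shift.
Local Open Scope ereal_scope.
Context (R : realType).
Implicit Types (s c x : R) (B : set R).
Notation mu := (@lebesgue_measure R).

Lemma measurable_shift c : measurable_fun [set: R] (shift c).
Proof. exact: measurable_funD. Qed.

Lemma lebesgue_measure_shift c B : measurable B ->
  mu (shift c @^-1` B) = mu B.
Proof.
move=> mB; rewrite -[LHS]/(pushforward mu (shift c : _ -> measurableTypeR R) B).
apply: esym; apply: lebesgue_measure_unique => //.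
  exact: measurable_shift.
move=> mshift _ [[a b]] _ <-.
transitivity (mu `](a - c)%R, (b - c)%R]).
  by rewrite !lebesgue_measure_itv/= !lte_fin ltrD2r -!EFinB opprB addrA subrK.
congr (mu _); apply/seteqP.
by split => x /=; rewrite !in_itv/= ltrBlDr lerBrDr.
Qed.

(** The density of N(c, s^2) divided by that of N(0, s^2), at [x]. *)
Definition gaussian_lr s c x : R := expR ((x * c - c ^+ 2 / 2) / s ^+ 2).

Lemma gaussian_lr_ge0 s c x : (0 <= gaussian_lr s c x)%R.
Proof. exact: expR_ge0. Qed.

Lemma measurable_gaussian_lr s c : measurable_fun [set: R] (gaussian_lr s c).
Proof.
apply: measurableT_comp => //; apply: measurable_funM => //.
by apply: measurable_funB => //; exact: measurable_funM.
Qed.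

Lemma normal_pdf_shift s c x : s != 0%R ->
  (normal_pdf 0 s x * gaussian_lr s c x)%R = normal_pdf 0 s (x - c)%R.
Proof.
move=> s0; rewrite !normal_pdfE// -mulrA -expRD; congr (_ * expR _)%R.
by rewrite -(mulr_natr (s ^+ 2)); field.
Qed.

(** Both sides are the mass that N(c, s^2) gives to [B]: multiplying the density
    by the ratio moves its centre, and Lebesgue measure is invariant under
    translations. *)
Lemma normal_prob_shift s c B : s != 0%R -> measurable B ->
  \int[normal_prob 0 s]_x (\1_B x * gaussian_lr s c x)%:E =
  normal_prob 0 s (shift c @^-1` B).
Proof.
move=> s0 mB.
have mshift := measurable_shift c.
have mlr := measurable_gaussian_lr s c.
have mpdf := measurable_normal_pdf (0 : R) s.
have mf : measurable_fun [set: R] (fun x => (\1_B x * gaussian_lr s c x)%:E).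
  by apply/measurable_EFinP; exact: measurable_funM.
have f0 x : 0 <= (\1_B x * gaussian_lr s c x)%:E.
  by rewrite lee_fin mulr_ge0// gaussian_lr_ge0.
rewrite (ge0_integral_density (mu := mu) (phi := id)
  (@measurable_id _ _ _) mpdf (normal_pdf_ge0 _ _) _ mf f0)//.
pose F y : \bar R := (\1_B y * normal_pdf 0 s (y - c))%:E.
have mF : measurable_fun [set: R] F.
  apply/measurable_EFinP; apply: measurable_funM; first exact: measurable_indic.
  by apply: (measurableT_comp mpdf); exact: measurable_funB.
transitivity (\int[mu]_y F y).
  apply: eq_integral => x _.
  by rewrite -EFinM -mulrA [(gaussian_lr _ _ _ * _)%R]mulrC normal_pdf_shift.
transitivity (\int[pushforward mu
    (shift c : measurableTypeR R -> measurableTypeR R)]_y F y).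
  apply: eq_measure_integral => A mA _; exact/esym/lebesgue_measure_shift.
rewrite ge0_integral_pushforward//; last first.
  by move=> y _; rewrite lee_fin mulr_ge0// normal_pdf_ge0.
rewrite /normal_prob [RHS]integral_mkcond preimage_setT.
apply: eq_integral => x _.
rewrite /F /= patchE /indic addrK.
rewrite [_ \in B](_ : _ = (x \in shift c @^-1` B)).
  by case: ifP => _ /=; rewrite ?mul1r ?mul0r.
by apply/idP/idP; rewrite !inE.
Qed.

End gaussian_shift.

Section product_space.
Local Open Scope ereal_scope.
Context (R : realType) (I : finType).

(** Boxes generate the product sigma-algebra and form a pi-system, and
    independence determines a joint law on them. *)
Definition box (B : I -> set R) : set (I -> R) := [set x | forall i, B i (x i)].

Definition boxes : set (set (I -> R)) :=
  [set box B | B in [set B : I -> set R | forall i, measurable (B i)]].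

Definition samples := g_sigma_algebraType boxes.

Lemma setI_closed_boxes : setI_closed boxes.
Proof.
move=> _ _ [B mB <-] [C mC <-]; exists (fun i => B i `&` C i).
  by move=> i /=; apply: measurableI; [exact: mB|exact: mC].
apply/seteqP; split=> x /=.
  by move=> BC; split => i; have [] := BC i.
by move=> [Bx Cx] i; split; [exact: Bx|exact: Cx].
Qed.

Lemma boxes_setT : boxes setT.
Proof. by exists (fun=> setT) => //; apply/seteqP; split. Qed.

Lemma measurable_samples_coord i :
  measurable_fun [set: samples] (fun x : samples => x i).
Proof.
move=> _ A mA; rewrite setTI; apply: sub_sigma_algebra.
exists (fun j => if j == i then A else setT) => [j|]; first by case: ifP.
apply/seteqP; split=> [x /(_ i)|x Ax j] /=; first by rewrite eqxx.
by case: eqVneq => // ->.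
Qed.

Lemma preimage_box d (T : measurableType d) (h : T -> samples) B :
  h @^-1` box B = \bigcap_(i in [set: I]) ((fun w => h w i) @^-1` B i).
Proof.
by apply/seteqP; split=> w hw i; [move=> _; exact: hw|exact: hw].
Qed.

Lemma measurable_fun_samples d (T : measurableType d) (h : T -> samples) :
  (forall i, measurable_fun setT (fun w => h w i)) -> measurable_fun setT h.
Proof.
move=> mh; apply: (measurability (boxes : set (set samples))) => //.
move=> _ [_ [B mB <-] <-].
rewrite setTI preimage_box; apply: fin_bigcap_measurable => // i _.
by rewrite -[X in measurable X]setTI; exact: mh.
Qed.

Definition shift_on (J : seq I) (c : I -> R) (x : samples) : samples :=
  fun i => (x i + (if i \in J then c i else 0))%R.

Lemma measurable_shift_on J c : measurable_fun setT (shift_on J c).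
Proof.
apply: measurable_fun_samples => i; apply: measurable_funD => //.
exact: measurable_samples_coord.
Qed.

Lemma shift_on_cons i J c x : i \notin J ->
  shift_on (i :: J) c x = shift_on J c (shift_on [:: i] c x).
Proof.
move=> iJ; apply/funext => j; rewrite /shift_on !inE.
by case: eqVneq => [->|_] /=; rewrite ?(negbTE iJ) ?addr0.
Qed.

End product_space.

Section cameron_martin.
Local Open Scope ereal_scope.
Context (R : realType) (I : finType) d (Omega : measurableType d).
Variables (P : probability Omega R) (X : I -> {RV P >-> R}) (s : I -> R).
Hypothesis s_neq0 : forall i, s i != 0%R.
Hypothesis law_X : forall i A, measurable A ->
  distribution P (X i) A = normal_prob 0 (s i) A.
Hypothesis indep_X : mutually_independent X.

Let XX (w : Omega) : samples R I := X^~ w.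

Lemma measurable_joint : measurable_fun setT XX.
Proof. by apply: measurable_fun_samples => i. Qed.

Lemma indep_box t (B : I -> set R) (C : set R) :
  (forall i, measurable (B i)) -> measurable C ->
  let A := \bigcap_(i in [set` [set~ t]%SET]) (X i @^-1` B i) in
  P (A `&` X t @^-1` C) = P A * P (X t @^-1` C).
Proof.
move=> mB mC A; pose D i := if i == t then C else B i.
have mD i : measurable (D i) by rewrite /D; case: ifP.
have -> : A `&` X t @^-1` C =
    \bigcap_(i in [set` [set: I]%SET]) (X i @^-1` D i).
  apply/seteqP; split => [w [Aw Cw] i _ /=|w Dw].
    rewrite /D; case: eqVneq => [->//|it].
    by apply: Aw; rewrite /= !inE.
  split => [i /=|]; last by have := Dw t; rewrite /= /D eqxx !inE; exact.
  by rewrite !inE => it; have := Dw i; rewrite /= /D (negbTE it) inE; exact.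
rewrite (indep_X _ mD) (bigD1 t) ?inE//= muleC; congr (_ * _).
  rewrite /A (indep_X _ mB); apply: eq_big => [i|i]; first by rewrite !inE.
  by rewrite inE /= /D => /negbTE ->.
by rewrite /D eqxx.
Qed.

(** The event on the coordinates other than [t] is independent of [X t].  So
    under [P] restricted to it, [X t] has a multiple of its Gaussian law, and
    the one-dimensional formula applies. *)
Lemma cameron_martin_box t c (B : I -> set R) :
  (forall i, measurable (B i)) ->
  \int[P]_(w in XX @^-1` box B) (gaussian_lr (s t) (c t) (X t w))%:E =
  P ((fun w => shift_on [:: t] c (XX w)) @^-1` box B).
Proof.
move=> mB.
pose A := \bigcap_(i in [set` [set~ t]%SET]) (X i @^-1` B i).
have mX i C : measurable C -> measurable (X i @^-1` C).
  by move=> mC; exact: measurable_funPTI.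
have mA : measurable A.
  by apply: fin_bigcap_measurable => // i _; exact: mX.
have mXt : measurable_fun setT (X t) by [].
have mBt := mB t.
have mlr := measurable_gaussian_lr (s t) (c t).
have mshift : measurable (shift (c t) @^-1` B t).
  by rewrite -[X in measurable X]setTI; exact: measurable_shift.
have -> : (fun w => shift_on [:: t] c (XX w)) @^-1` box B =
    A `&` X t @^-1` (shift (c t) @^-1` B t).
  apply/seteqP; split => w.
    move=> Bw; split => [i|] /=.
      rewrite !inE => /negbTE it; have := Bw i.
      by rewrite /shift_on inE it addr0.
    by have := Bw t; rewrite /shift_on inE eqxx.
  move=> [Aw Bw] i; rewrite /shift_on inE; case: eqVneq => [->//|it].
  by rewrite addr0; apply: Aw; rewrite /= !inE.
have -> : XX @^-1` box B = A `&` X t @^-1` B t.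
  apply/seteqP; split => w.
    by move=> Bw; split => [i _|]; exact: Bw.
  move=> [Aw Bw] i; case: (eqVneq i t) => [->//|it].
  by apply: Aw; rewrite /= !inE.
have indepA C (mC : measurable C) := indep_box t mB mC.
rewrite -/A in indepA.
rewrite indepA//.
have PA0 : (0 <= fine (P A))%R by exact: fine_ge0.
pose nu := mscale (NngNum PA0) (normal_prob 0 (s t)).
have nuE (C : set R) : measurable C ->
    nu C = \int[P]_(w in X t @^-1` C) (\1_A w)%:E.
  move=> mC; rewrite integral_indic//; last exact: mX.
  transitivity (P A * P (X t @^-1` C)); last exact/esym/indepA.
  rewrite /nu /mscale /= fineK ?fin_num_measure//.
  by congr (_ * _); exact/esym/law_X.
have mf : measurable_fun [set: R]
    (fun x => (\1_(B t) x * gaussian_lr (s t) (c t) x)%:E).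
  by apply/measurable_EFinP; exact: measurable_funM.
have f0 x : 0 <= (\1_(B t) x * gaussian_lr (s t) (c t) x)%:E.
  by rewrite lee_fin mulr_ge0// gaussian_lr_ge0.
have := ge0_integral_density (mu := P) (nu := nu) (phi := X t) (g := \1_A)
  mXt _ _ nuE mf f0.
rewrite ge0_integral_mscale//= normal_prob_shift// fineK ?fin_num_measure//.
rewrite -law_X// => ->//.
rewrite integral_mkcond; apply: eq_integral => w _.
rewrite patchE in_setI /indic /=.
rewrite [_ \in X t @^-1` _](_ : _ = (X t w \in B t)).
  by do 2 case: (_ \in _); rewrite /= ?mul1r ?mul0r ?mule1 ?mule0.
  by apply/idP/idP; rewrite !inE.
Qed.

(** Both sides integrate [f] against finite measures that agree on boxes. *)
Lemma cameron_martin1 t c (f : samples R I -> \bar R) :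
  measurable_fun setT f -> (forall x, 0 <= f x) ->
  \int[P]_w f (shift_on [:: t] c (XX w)) =
  \int[P]_w (f (XX w) * (gaussian_lr (s t) (c t) (X t w))%:E).
Proof.
move=> mf f0; pose phi w := shift_on [:: t] c (XX w).
have mphi : measurable_fun setT phi.
  exact: measurableT_comp (@measurable_shift_on _ _ _ _) measurable_joint.
have mlr : measurable_fun setT (fun w => gaussian_lr (s t) (c t) (X t w)).
  exact: measurableT_comp (@measurable_gaussian_lr _ _ _)
    (measurable_funP (X t)).
have lr0 w : (0 <= gaussian_lr (s t) (c t) (X t w))%R by exact: gaussian_lr_ge0.
have [nu nuE] := density_measure P measurable_joint mlr lr0.
have lawE A : measurable A -> pushforward P phi A = nu A.
  pose m := measure_function_pushforward__canonical__measure_function_Measure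
    P mphi.
  move=> mA; apply: (measure_unique (@boxes R I : set (set (samples R I)))
    (fun=> setT) _ _ _ _ m nu) => //.
  - exact: setI_closed_boxes.
  - by move=> _; exact: boxes_setT.
  - by rewrite bigcup_const.
  - by move=> _ [B mB <-]; rewrite nuE cameron_martin_box.
  - by move=> _; rewrite /m /= /pushforward preimage_setT probability_setT ltry.
transitivity (\int[pushforward P phi]_x f x).
  by rewrite ge0_integral_pushforward// => x _; exact: f0.
rewrite -(ge0_integral_density measurable_joint mlr lr0
  (fun B _ => nuE B) mf f0).
by apply: eq_measure_integral => A mA _; exact: lawE.
Qed.

Definition joint_lr (J : seq I) (c : I -> R) (x : I -> R) : R :=
  (\prod_(i <- J) gaussian_lr (s i) (c i) (x i))%R.

Lemma measurable_joint_lr J c :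
  measurable_fun setT (joint_lr J c : samples R I -> R).
Proof.
apply: (@measurable_prod _ (samples R I)) => i _.
exact: measurableT_comp (@measurable_gaussian_lr _ _ _)
  (@measurable_samples_coord _ _ _).
Qed.

Lemma joint_lr_ge0 J c x : (0 <= joint_lr J c x)%R.
Proof. by apply: prodr_ge0 => i _; exact: gaussian_lr_ge0. Qed.

(** Shifting one more coordinate [i] costs the factor at [i]; that factor
    depends on the coordinate [i] only, hence commutes with the shift of the
    others. *)
Lemma cameron_martin_seq (J : seq I) c (f : samples R I -> \bar R) : uniq J ->
  measurable_fun setT f -> (forall x, 0 <= f x) ->
  \int[P]_w f (shift_on J c (XX w)) =
  \int[P]_w (f (XX w) * (joint_lr J c (XX w))%:E).
Proof.
elim: J f => [|i J IH] f /=.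
  move=> _ _ _; apply: eq_integral => w _; rewrite /joint_lr big_nil mule1.
  by congr f; apply/funext => i; rewrite /shift_on addr0.
move=> /andP[iJ uJ] mf f0.
under eq_integral do rewrite shift_on_cons//.
rewrite (cameron_martin1 i c (f := fun x => f (shift_on J c x)))//; last first.
  exact: measurableT_comp mf (@measurable_shift_on _ _ _ _).
pose g (x : samples R I) := f x * (gaussian_lr (s i) (c i) (x i))%:E.
have -> : \int[P]_w (f (shift_on J c (XX w)) *
      (gaussian_lr (s i) (c i) (X i w))%:E) =
    \int[P]_w g (shift_on J c (XX w)).
  by apply: eq_integral => w _; rewrite /g /= {3}/shift_on (negbTE iJ) addr0.
rewrite IH//; last 2 first.
- apply: emeasurable_funM => //; apply/measurable_EFinP.
  exact: measurableT_comp (@measurable_gaussian_lr _ _ _)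
    (@measurable_samples_coord _ _ _).
- by move=> x; rewrite mule_ge0// lee_fin gaussian_lr_ge0.
by apply: eq_integral => w _; rewrite /g /joint_lr big_cons EFinM muleA.
Qed.

End cameron_martin.

(** From here on every coordinate is shifted: [XXc] is the observation in the
    model shifted by [c], and [L] is the likelihood ratio of that model. *)
Section signed_cameron_martin.
Local Open Scope ereal_scope.
Context (R : realType) (I : finType) d (Omega : measurableType d).
Variables (P : probability Omega R) (X : I -> {RV P >-> R}) (s : I -> R).
Hypothesis s_neq0 : forall i, s i != 0%R.
Hypothesis law_X : forall i A, measurable A ->
  distribution P (X i) A = normal_prob 0 (s i) A.
Hypothesis indep_X : mutually_independent X.
Variable c : I -> R.

Let XX (w : Omega) : samples R I := X^~ w.
Let XXc (w : Omega) : samples R I := fun i => (X i w + c i)%R.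
Let L (w : Omega) : R := joint_lr s (enum I) c (XX w).

Lemma measurable_lr : measurable_fun setT L.
Proof.
exact: measurableT_comp (@measurable_joint_lr _ _ _ _ _) (measurable_joint X).
Qed.

Lemma ge0_cameron_martin (f : samples R I -> \bar R) :
  measurable_fun setT f -> (forall x, 0 <= f x) ->
  \int[P]_w f (XXc w) = \int[P]_w (f (XX w) * (L w)%:E).
Proof.
move=> mf f0.
rewrite -(cameron_martin_seq s_neq0 law_X indep_X c (enum_uniq I) mf f0).
apply: eq_integral => w _; congr f; apply/funext => i.
by rewrite /shift_on mem_enum.
Qed.

(** The positive and negative parts agree separately, and an integral is by
    definition the difference of theirs. *)
Lemma cameron_martin (f : samples R I -> R) : measurable_fun setT f ->
  \int[P]_w (f (XXc w))%:E = \int[P]_w (f (XX w) * L w)%:E.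
Proof.
move=> mf; rewrite [LHS]integralE [RHS]integralE.
have max0M (a l : R) : (0 <= l)%R ->
    maxe (a * l)%:E 0 = maxe a%:E 0 * l%:E.
  move=> l0; rewrite -[LHS](EFin_max (a * l)%R 0%R).
  by rewrite -[maxe a%:E 0](EFin_max a 0%R) -EFinM maxr_pMl// mul0r.
have mfE : measurable_fun setT (EFin \o f) by exact/measurable_EFinP.
congr (_ - _).
  rewrite (eq_integral (fun w => (EFin \o f)^\+ (XXc w))); last first.
    by move=> w _; rewrite !funeposE.
  rewrite ge0_cameron_martin//; last exact: measurable_funepos.
  apply: eq_integral => w _; rewrite !funeposE /=.
  by rewrite max0M// joint_lr_ge0.
rewrite (eq_integral (fun w => (EFin \o f)^\- (XXc w))); last first.
  by move=> w _; rewrite !funenegE.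
rewrite ge0_cameron_martin//; last exact: measurable_funeneg.
apply: eq_integral => w _; rewrite !funenegE /=.
by rewrite -mulNr max0M// joint_lr_ge0.
Qed.

Lemma integral_lr : \int[P]_w (L w)%:E = 1.
Proof.
have := @cameron_martin (cst 1%R) (@measurable_cst _ _ _ _ _ _).
under [X in _ = X -> _]eq_integral do rewrite mul1r.
move=> /= <-; rewrite integral_cst// mul1e; exact: probability_setT.
Qed.

(** [E L^2 = E L(X + c)], and [L(X + c)] is [L(X)] times a constant. *)
Lemma integral_lr_sqr :
  \int[P]_w (L w ^+ 2)%:E = (expR (\sum_i (c i / s i) ^+ 2))%:E.
Proof.
have := cameron_martin (@measurable_joint_lr _ _ s (enum I) c).
under [X in _ = X -> _]eq_integral do rewrite -expr2.
move=> <-.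
have LE w : joint_lr s (enum I) c (XXc w) =
    (expR (\sum_i (c i / s i) ^+ 2) * L w)%R.
  rewrite expR_sum -big_enum /L /joint_lr -big_split; apply: eq_bigr => i _ /=.
  rewrite /gaussian_lr -expRD; congr expR; rewrite /XXc /XX; field.
  exact: s_neq0.
under eq_integral do rewrite LE EFinM.
rewrite ge0_integralZl ?integral_lr ?mule1//.
- exact/measurable_EFinP/measurable_lr.
- by move=> w _; rewrite lee_fin joint_lr_ge0.
Qed.

End signed_cameron_martin.

(** * The Chapman-Robbins inequality *)

Section chapman_robbins.
Local Open Scope ereal_scope.
Context (R : realType) d (Omega : measurableType d) (P : probability Omega R).
Implicit Types (f g D L : Omega -> R).

(** Means are carried together with integrability, so that linear combinations
    can be integrated without side conditions. *)
Let mean f a := P.-integrable setT (EFin \o f) /\ \int[P]_w (f w)%:E = a%:E.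

Let meanD f g a b : mean f a -> mean g b -> mean (f \+ g)%R (a + b)%R.
Proof.
move=> [fi fa] [gi gb]; split; first exact: (integrableD measurableT fi gi).
by rewrite EFinD -fa -gb -integralD.
Qed.

Let meanZ f a k : mean f a -> mean (fun w => k * f w)%R (k * a)%R.
Proof.
move=> [fi fa]; split; first exact: (integrableZl measurableT k fi).
by rewrite EFinM -fa -integralZl.
Qed.

Let mean_cst k : mean (cst k) k.
Proof.
split; first exact: finite_measure_integrable_cst.
rewrite /= integral_cst//; transitivity (k%:E * 1); last by rewrite mule1.
by congr (_ * _); exact: probability_setT.
Qed.

Let mean_dom f g b : measurable_fun setT f -> mean g b ->
  (forall w, `|f w| <= g w)%R -> P.-integrable setT (EFin \o f).
Proof.
move=> mf [gi _] fg; apply: le_integrable gi => //.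
  exact/measurable_EFinP.
by move=> w _; rewrite lee_fin (le_trans (fg w))// ler_norm.
Qed.

Let mean_eq f a b : mean f a -> \int[P]_w (f w)%:E = b%:E -> a = b.
Proof. by move=> [_ ->] []. Qed.

(** The expectation of [(D - m - t (L - 1))^2] is nonnegative.  When the
    variance is infinite there is nothing to prove; otherwise [D - m] and [L]
    are square integrable and the square can be expanded under the integral.
    Keeping [t] free avoids dividing by [q - 1], which may be 0. *)
Lemma chapman_robbins D L (m m' q t : R) :
  measurable_fun setT D -> measurable_fun setT L ->
  \int[P]_w (D w)%:E = m%:E -> \int[P]_w (D w * L w)%:E = m'%:E ->
  \int[P]_w (L w)%:E = 1 -> \int[P]_w (L w ^+ 2)%:E = q%:E ->
  (2 * t * (m' - m))%:E <=
  \int[P]_w ((D w - m) ^+ 2)%:E + (t ^+ 2 * (q - 1))%:E.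
Proof.
move=> mD mL ED EDL EL EL2.
pose Y w := (D w - m)%R.
have mY : measurable_fun setT Y by exact: measurable_funB.
have V0 : 0 <= \int[P]_w (Y w ^+ 2)%:E.
  by apply: integral_ge0 => w _; rewrite lee_fin sqr_ge0.
have [Voo|] := eqVneq (\int[P]_w (Y w ^+ 2)%:E) +oo.
  by rewrite Voo addye// leey.
move=> Vfin; have {}Vfin : \int[P]_w (Y w ^+ 2)%:E < +oo by rewrite ltey.
have sqr_mean f v : measurable_fun setT f -> \int[P]_w (f w ^+ 2)%:E = v%:E ->
    mean (fun w => f w ^+ 2)%R v.
  move=> mf fv; split => //; apply/integrableP; split.
    by apply/measurable_EFinP; exact: measurable_funX.
  under eq_integral do rewrite /= ger0_norm ?sqr_ge0//.
  by rewrite fv ltry.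
have VE := @fineK _ (\int[P]_w (Y w ^+ 2)%:E).
rewrite ge0_fin_numE// in VE; move: VE => /(_ Vfin) /esym VE.
set v := fine _ in VE.
have Y2 := sqr_mean _ _ mY VE.
have L2 := sqr_mean _ _ mL EL2.
have le_sqr1 (x : R) : (`|x| <= x ^+ 2 + 1)%R.
  by rewrite -(real_normK (num_real x)); have := sqr_ge0 (`|x| - 2^-1)%R; lra.
have Yi : P.-integrable setT (EFin \o Y).
  by apply: (mean_dom mY (meanD Y2 (mean_cst 1))) => w; exact: le_sqr1.
have Li : P.-integrable setT (EFin \o L).
  by apply: (mean_dom mL (meanD L2 (mean_cst 1))) => w; exact: le_sqr1.
have YLi : P.-integrable setT (EFin \o (fun w => Y w * L w)%R).
  apply: (mean_dom _ (meanD Y2 L2)) => [|w]; first exact: measurable_funM.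
  rewrite normrM /=.
  rewrite -(real_normK (num_real (Y w))) -(real_normK (num_real (L w))).
  by have := sqr_ge0 (`|Y w| - `|L w|)%R; nra.
have Lm : mean L 1 by [].
have mean_fin f : P.-integrable setT (EFin \o f) ->
    mean f (fine (\int[P]_w (f w)%:E)).
  by move=> fi; split => //; rewrite fineK// integrable_fin_num.
have Ym : mean Y 0.
  have := mean_fin _ Yi; set y := fine _ => Ym.
  suff -> : 0%R = y by [].
  apply: (addIr m); rewrite add0r; apply/esym.
  apply: (mean_eq (meanD Ym (mean_cst m))); rewrite -ED.
  by apply: eq_integral => w _ /=; rewrite subrK.
have YLm : mean (fun w => Y w * L w)%R (m' - m)%R.
  have := mean_fin _ YLi; set y := fine _ => YLm.
  suff -> : (m' - m = y)%R by [].
  apply: (addIr (m * 1)%R); rewrite mulr1 subrK; apply/esym.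
  have := mean_eq (meanD YLm (meanZ m Lm)); rewrite mulr1; apply; rewrite -EDL.
  by apply: eq_integral => w _ /=; rewrite /Y -mulrDl subrK.
have [_ W] := meanD (meanD (meanD Y2 (meanZ (t ^+ 2) L2)) (mean_cst (t ^+ 2)))
  (meanD (meanD (meanZ (- (2 * t)) YLm) (meanZ (2 * t) Ym))
    (meanZ (- (2 * t ^+ 2)) Lm)).
have : 0 <= \int[P]_w ((Y w - t * (L w - 1)) ^+ 2)%:E.
  by apply: integral_ge0 => w _; rewrite lee_fin sqr_ge0.
under eq_integral.
  move=> w _; rewrite (_ : (_ ^+ 2)%R =
    ((Y w ^+ 2 + t ^+ 2 * L w ^+ 2 + t ^+ 2) +
    (- (2 * t) * (Y w * L w) + 2 * t * Y w + - (2 * t ^+ 2) * L w))%R);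
    last by ring.
  over.
rewrite W VE !lee_fin; lra.
Qed.

End chapman_robbins.

(** * Mode products and the Tucker rank *)

Section mode_products.
Context (R : realType).

(** Indices of modes are cyclic: [unfold2 T] and [unfold3 T] are convertible to
    [unfold1 (rot T)] and [unfold1 (rot (rot T))], and similarly for products,
    so a property of the first mode transfers to the other two. *)
Definition rot p1 p2 p3 (T : tensor R p1 p2 p3) : tensor R p2 p3 p1 :=
  fun j k i => T i j k.

Lemma unfold1_mode1 q p1 p2 p3 (T : tensor R p1 p2 p3) (B : 'M[R]_(q, p1)) :
  unfold1 (mode1_prod T B) = B *m unfold1 T.
Proof.
apply/matrixP => i l; rewrite !mxE; case/mxvec_indexP: l => j k.
by rewrite mxvecE mxE; apply: eq_bigr => a _; rewrite mxE mxvecE mxE.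
Qed.

Lemma rank_unfold1_mode1_le p1 p2 p3 (T : tensor R p1 p2 p3) (B : 'M[R]_p1) :
  (\rank (unfold1 (mode1_prod T B)) <= \rank (unfold1 T))%N.
Proof. by rewrite unfold1_mode1 mxrankM_maxr. Qed.

Lemma rank_unfold1_mode2_le p1 p2 p3 (T : tensor R p1 p2 p3) (B : 'M[R]_p2) :
  (\rank (unfold1 (mode2_prod T B)) <= \rank (unfold1 T))%N.
Proof.
have -> : unfold1 (mode2_prod T B) = unfold1 T *m lin_mulmx B.
  apply/row_matrixP => i; rewrite row_mul !rowK mul_vec_lin; congr mxvec.
  apply/matrixP => j k; rewrite !mxE; apply: eq_bigr => a _.
  by rewrite mxE.
exact: mxrankM_maxl.
Qed.

Lemma rank_unfold1_mode3_le p1 p2 p3 (T : tensor R p1 p2 p3) (B : 'M[R]_p3) :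
  (\rank (unfold1 (mode3_prod T B)) <= \rank (unfold1 T))%N.
Proof.
have -> : unfold1 (mode3_prod T B) = unfold1 T *m lin_mulmxr B^T.
  apply/row_matrixP => i; rewrite row_mul !rowK mul_vec_lin; congr mxvec.
  apply/matrixP => j k; rewrite !mxE; apply: eq_bigr => a _.
  by rewrite !mxE mulrC.
exact: mxrankM_maxl.
Qed.

Lemma mode1_prodK p1 p2 p3 (T : tensor R p1 p2 p3) (B C : 'M[R]_p1) :
  C *m B = 1%:M -> mode1_prod (mode1_prod T B) C = T.
Proof.
move=> CB; apply/funext => i; apply/funext => j; apply/funext => k.
have : unfold1 (mode1_prod (mode1_prod T B) C) = unfold1 T.
  by rewrite !unfold1_mode1 mulmxA CB mul1mx.
by move=> /matrixP/(_ i (mxvec_index j k)); rewrite !mxE !mxvecE !mxE.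
Qed.

Lemma tucker_rank_rot p1 p2 p3 r1 r2 r3 (T : tensor R p1 p2 p3) :
  has_tucker_rank r1 r2 r3 T <-> has_tucker_rank r2 r3 r1 (rot T).
Proof. by split=> -[]. Qed.

(** No mode product increases the rank of an unfolding; an invertible one can be
    undone, so it does not decrease it either. *)
Lemma tucker_rank_mode1 p1 p2 p3 r1 r2 r3 (T : tensor R p1 p2 p3)
    (B : 'M[R]_p1) :
  B \in unitmx -> has_tucker_rank r1 r2 r3 T ->
  has_tucker_rank r1 r2 r3 (mode1_prod T B).
Proof.
move=> uB [T1 T2 T3].
have K : mode1_prod (mode1_prod T B) (invmx B) = T.
  by rewrite mode1_prodK ?mulVmx.
split; apply/eqP; rewrite eqn_leq; apply/andP; split.
- by rewrite -T1 rank_unfold1_mode1_le.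
- by rewrite -T1 -[in X in (X <= _)%N]K rank_unfold1_mode1_le.
- by rewrite -T2; exact: (rank_unfold1_mode3_le (rot T) B).
- rewrite -T2 -[in X in (X <= _)%N]K.
  exact: (rank_unfold1_mode3_le (rot (mode1_prod T B)) (invmx B)).
- by rewrite -T3; exact: (rank_unfold1_mode2_le (rot (rot T)) B).
- rewrite -T3 -[in X in (X <= _)%N]K.
  exact: (rank_unfold1_mode2_le (rot (rot (mode1_prod T B))) (invmx B)).
Qed.

Lemma tucker_rank_mode2 p1 p2 p3 r1 r2 r3 (T : tensor R p1 p2 p3)
    (B : 'M[R]_p2) :
  B \in unitmx -> has_tucker_rank r1 r2 r3 T ->
  has_tucker_rank r1 r2 r3 (mode2_prod T B).
Proof.
move=> uB /tucker_rank_rot /(tucker_rank_mode1 uB) h.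
exact/tucker_rank_rot.
Qed.

Lemma tucker_rank_mode3 p1 p2 p3 r1 r2 r3 (T : tensor R p1 p2 p3)
    (B : 'M[R]_p3) :
  B \in unitmx -> has_tucker_rank r1 r2 r3 T ->
  has_tucker_rank r1 r2 r3 (mode3_prod T B).
Proof.
move=> uB /tucker_rank_rot/tucker_rank_rot /(tucker_rank_mode1 uB) h.
by apply/tucker_rank_rot/tucker_rank_rot.
Qed.

Lemma mode1_prod_1D p1 p2 p3 (T : tensor R p1 p2 p3) (A : 'M[R]_p1) h i j k :
  mode1_prod T (1%:M + h *: A) i j k = T i j k + h * mode1_prod T A i j k.
Proof.
rewrite /mode1_prod mulr_sumr.
under eq_bigr do rewrite !mxE mulrDl -mulrA.
rewrite big_split /= (bigD1 i)//= eqxx mul1r big1 ?addr0// => a /negbTE ai.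
by rewrite eq_sym ai mul0r.
Qed.

Lemma mode2_prod_1D p1 p2 p3 (T : tensor R p1 p2 p3) (A : 'M[R]_p2) h i j k :
  mode2_prod T (1%:M + h *: A) i j k = T i j k + h * mode2_prod T A i j k.
Proof. exact: (mode1_prod_1D (rot T)). Qed.

Lemma mode3_prod_1D p1 p2 p3 (T : tensor R p1 p2 p3) (A : 'M[R]_p3) h i j k :
  mode3_prod T (1%:M + h *: A) i j k = T i j k + h * mode3_prod T A i j k.
Proof. exact: (mode1_prod_1D (rot (rot T))). Qed.

Lemma unitmx_1D_nilp p (A : 'M[R]_p) h : A *m A = 0 -> 1%:M + h *: A \in unitmx.
Proof.
move=> A2; have : (1%:M + h *: A) *m (1%:M - h *: A) = 1%:M.
  rewrite mulmxDl !mulmxBr !mul1mx mulmx1 -scalemxAl -scalemxAr A2.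
  by rewrite !scaler0 subr0 subrK.
by move=> /mulmx1_unit[].
Qed.

End mode_products.

(** * Tangent directions at a tensor of given Tucker rank *)

Section tangent.
Context (R : realType).

Lemma norm2_sqr m n (A : 'M[R]_(m, n)) :
  norm2 A ^+ 2 = \sum_i \sum_j A i j ^+ 2.
Proof.
rewrite sqr_sqrtr// sumr_ge0// => i _.
by rewrite sumr_ge0// => j _; exact: sqr_ge0.
Qed.

Lemma norm2_row_sqr m n (A : 'M[R]_(m, n)) i :
  norm2 (row i A) ^+ 2 = (A *m A^T) i i.
Proof.
rewrite norm2_sqr big_ord1 mxE; apply: eq_bigr => j _.
by rewrite !mxE.
Qed.

(** With [unfold1 T = U L V^T], take [w = (I - U U^T) e_i], [x] the row of [V]
    at [(j, k)], [y = x V^T] and [A = w x L^-1 U^T].  Then [A U L V^T = w y].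
    Since [U^T w = 0], the square of [A] vanishes and so does the contraction
    of [w] with the first mode of [T]; the norms follow from [U^T U = I] and
    [V^T V = I]. *)
Lemma tangent_mode1 p1 p2 p3 r (T : tensor R p1 p2 p3)
    (S : rank_svd (unfold1 T) r) i j k :
  let u := norm2 (row i (svd_left S)) ^+ 2 in
  let v := norm2 (row (mxvec_index j k) (svd_right S)) ^+ 2 in
  exists A (w : 'I_p1 -> R) (y : 'I_p2 -> 'I_p3 -> R),
  [/\ A *m A = 0, forall a b c, mode1_prod T A a b c = w a * y b c,
      forall b c, \sum_a w a * T a b c = 0,
      w i = 1 - u /\ \sum_a w a ^+ 2 = 1 - u &
      y j k = v /\ \sum_b \sum_c y b c ^+ 2 = v].
Proof.
move=> u v; set U := svd_left S in u *; set V := svd_right S in v *.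
pose L := diag_mx (svd_values S).
pose Li := diag_mx (\row_a (svd_values S 0 a)^-1).
have UU : U^T *m U = 1%:M := svd_leftP S.
have VV : V^T *m V = 1%:M := svd_rightP S.
have TE : unfold1 T = U *m L *m V^T := svdE S.
have LiL : Li *m L = 1%:M.
  rewrite mulmx_diag; apply/matrixP => a b; rewrite !mxE.
  case: eqVneq => // ->; rewrite mulr1n mulVf// gt_eqF//; exact: svd_values_gt0.
pose W : 'cV[R]_p1 := delta_mx i 0 - U *m (U^T *m delta_mx i 0).
have UW : U^T *m W = 0 by rewrite /W mulmxBr (mulmxA U^T U) UU mul1mx subrr.
pose x := row (mxvec_index j k) V.
pose A := W *m x *m Li *m U^T.
have AT : A *m unfold1 T = W *m (x *m V^T).
  rewrite TE /A !mulmxA -(mulmxA _ U^T U) UU mulmx1.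
  by rewrite -(mulmxA _ Li L) LiL mulmx1.
have Wi : W i 0 = 1 - u.
  rewrite /u norm2_row_sqr /W mulmxA -colE.
  move: (U *m U^T) => M; rewrite !mxE !eqxx; done.
have WU : W^T *m U = 0 by rewrite -[LHS]trmxK trmx_mul trmxK UW trmx0.
have WE : W^T *m W = (W i 0)%:M.
  rewrite {2}/W mulmxBr (mulmxA _ U) WU mul0mx subr0 -colE.
  by rewrite [LHS]mx11_scalar [in LHS]mxE [in LHS]mxE.
have xE : x *m x^T = v%:M.
  rewrite [LHS]mx11_scalar /v norm2_row_sqr !mxE; congr (_%:M).
  by apply: eq_bigr => a _; rewrite !mxE.
clearbody W; exists A, (fun a => W a 0),
  (fun b c => (x *m V^T) 0 (mxvec_index b c)); split.
- by rewrite /A -!mulmxA (mulmxA U^T W) UW mul0mx !mulmx0.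
- move=> a b c.
  transitivity (unfold1 (mode1_prod T A) a (mxvec_index b c)).
    by rewrite mxE mxvecE mxE.
  by rewrite unfold1_mode1 AT mxE big_ord1.
- move=> b c; transitivity ((W^T *m unfold1 T) 0 (mxvec_index b c)).
    by rewrite mxE; apply: eq_bigr => a _; rewrite !mxE mxvecE mxE.
  have -> : W^T *m unfold1 T = 0.
    by rewrite TE !mulmxA WU !mul0mx.
  by rewrite mxE.
- split=> //; rewrite -Wi; transitivity ((W^T *m W) 0 0).
    by rewrite mxE; apply: eq_bigr => a _; rewrite mxE expr2.
  by rewrite WE mxE eqxx mulr1n.
- split; first by rewrite /v norm2_row_sqr /x -row_mul mxE.
  transitivity (\sum_l (x *m V^T) 0 l ^+ 2).
    rewrite pair_bigA /= (reindex _ (curry_mxvec_bij _ _)) /=.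
    by apply: eq_bigr => -[].
  have sqE (z : 'rV[R]_(p2 * p3)) : \sum_l z 0 l ^+ 2 = (z *m z^T) 0 0.
    by rewrite mxE; apply: eq_bigr => l _; rewrite mxE expr2.
  by rewrite sqE trmx_mul trmxK mulmxA -(mulmxA x) VV mulmx1 xE mxE eqxx mulr1n.
Qed.

Definition tdot p1 p2 p3 (X Y : tensor R p1 p2 p3) : R :=
  \sum_a \sum_b \sum_c X a b c * Y a b c.

Definition tadd p1 p2 p3 (X Y : tensor R p1 p2 p3) : tensor R p1 p2 p3 :=
  fun a b c => X a b c + Y a b c.

Lemma tdotC p1 p2 p3 (X Y : tensor R p1 p2 p3) : tdot X Y = tdot Y X.
Proof. by do 3! apply: eq_bigr => ? _; exact: mulrC. Qed.

Lemma tdot_rot p1 p2 p3 (X Y : tensor R p1 p2 p3) :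
  tdot (rot X) (rot Y) = tdot X Y.
Proof.
rewrite /tdot [RHS]exchange_big; apply: eq_bigr => b _.
by rewrite exchange_big.
Qed.

Lemma tdotDl p1 p2 p3 (X Y Z : tensor R p1 p2 p3) :
  tdot (tadd X Y) Z = tdot X Z + tdot Y Z.
Proof.
rewrite /tdot; do 3 (rewrite -big_split; apply: eq_bigr => ? _).
by rewrite /tadd mulrDl.
Qed.

Lemma tdotDr p1 p2 p3 (X Y Z : tensor R p1 p2 p3) :
  tdot Z (tadd X Y) = tdot Z X + tdot Z Y.
Proof. by rewrite !(tdotC Z) tdotDl. Qed.

(** A product in the second mode preserves the fact that [w] annihilates the
    first one. *)
Lemma tdot_mode1_mode2 p1 p2 p3 (T : tensor R p1 p2 p3) A1 (A2 : 'M[R]_p2) w y :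
  (forall a b c, mode1_prod T A1 a b c = w a * y b c) ->
  (forall b c, \sum_a w a * T a b c = 0) ->
  tdot (mode1_prod T A1) (mode2_prod T A2) = 0.
Proof.
move=> D1 wT; rewrite /tdot exchange_big big1// => b _.
rewrite exchange_big big1// => c _.
transitivity (y b c * \sum_b' A2 b b' * \sum_a w a * T a b' c).
  rewrite mulr_sumr.
  under eq_bigr do rewrite D1 /mode2_prod mulr_sumr.
  rewrite exchange_big; apply: eq_bigr => b' _ /=.
  rewrite !mulr_sumr; apply: eq_bigr => a _; ring.
by rewrite big1 ?mulr0// => b' _; rewrite wT mulr0.
Qed.

Lemma tdot_outer p1 p2 p3 (D : tensor R p1 p2 p3) w y :
  (forall a b c, D a b c = w a * y b c) ->
  tdot D D = (\sum_a w a ^+ 2) * \sum_b \sum_c y b c ^+ 2.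
Proof.
move=> DE; rewrite mulr_suml; apply: eq_bigr => a _.
rewrite mulr_sumr; apply: eq_bigr => b _.
rewrite mulr_sumr; apply: eq_bigr => c _.
by rewrite DE -expr2 exprMn.
Qed.

Lemma mode1_prod_lin p1 p2 p3 (X Y : tensor R p1 p2 p3) (A : 'M[R]_p1) h i j k :
  mode1_prod (fun a b c => X a b c + h * Y a b c) A i j k =
  mode1_prod X A i j k + h * mode1_prod Y A i j k.
Proof.
rewrite /mode1_prod mulr_sumr -big_split; apply: eq_bigr => a _ /=; ring.
Qed.

Lemma mode2_prod_lin p1 p2 p3 (X Y : tensor R p1 p2 p3) (A : 'M[R]_p2) h i j k :
  mode2_prod (fun a b c => X a b c + h * Y a b c) A i j k =
  mode2_prod X A i j k + h * mode2_prod Y A i j k.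
Proof. exact: (mode1_prod_lin (rot X) (rot Y)). Qed.

Lemma mode3_prod_lin p1 p2 p3 (X Y : tensor R p1 p2 p3) (A : 'M[R]_p3) h i j k :
  mode3_prod (fun a b c => X a b c + h * Y a b c) A i j k =
  mode3_prod X A i j k + h * mode3_prod Y A i j k.
Proof. exact: (mode1_prod_lin (rot (rot X)) (rot (rot Y))). Qed.

Lemma multiplicative_curve p1 p2 p3 (T : tensor R p1 p2 p3) A1 A2 A3 :
  let D := tadd (mode1_prod T A1) (tadd (mode2_prod T A2) (mode3_prod T A3)) in
  exists E F : tensor R p1 p2 p3, forall h,
    mode3_prod (mode2_prod (mode1_prod T (1%:M + h *: A1)) (1%:M + h *: A2))
      (1%:M + h *: A3) =
    fun a b c => T a b c + h * (D a b c + h * (E a b c + h * F a b c)).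
Proof.
move=> D.
pose D1 := mode1_prod T A1; pose D2 := mode2_prod T A2.
pose D12 := mode2_prod D1 A2.
exists (tadd D12 (tadd (mode3_prod D1 A3) (mode3_prod D2 A3))).
exists (mode3_prod D12 A3).
move=> h.
have X1 : mode1_prod T (1%:M + h *: A1) = fun a b c => T a b c + h * D1 a b c.
  by do 3 (apply/funext => ?); rewrite mode1_prod_1D.
have X2 : mode2_prod (mode1_prod T (1%:M + h *: A1)) (1%:M + h *: A2) =
    fun a b c => (T a b c + h * D1 a b c) + h * (D2 a b c + h * D12 a b c).
  by do 3 (apply/funext => ?); rewrite mode2_prod_1D X1 mode2_prod_lin.
do 3 (apply/funext => ?); rewrite mode3_prod_1D X2.
rewrite (mode3_prod_lin (fun a b c => T a b c + h * D1 a b c)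
  (fun a b c => D2 a b c + h * D12 a b c)) !mode3_prod_lin /D /tadd -/D1 -/D2.
ring.
Qed.

(** The remainder is kept in the polynomial form [h^2 E + h^3 F], which makes
    its continuity in [h] evident. *)
Lemma tangent_curve p1 p2 p3 r1 r2 r3 (T : tensor R p1 p2 p3)
    (S1 : rank_svd (unfold1 T) r1) (S2 : rank_svd (unfold2 T) r2)
    (S3 : rank_svd (unfold3 T) r3) i j k :
  has_tucker_rank r1 r2 r3 T ->
  let g :=
    (1 - norm2 (row i (svd_left S1)) ^+ 2) *
      norm2 (row (mxvec_index j k) (svd_right S1)) ^+ 2 +
    ((1 - norm2 (row j (svd_left S2)) ^+ 2) *
      norm2 (row (mxvec_index k i) (svd_right S2)) ^+ 2 +
    (1 - norm2 (row k (svd_left S3)) ^+ 2) *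
      norm2 (row (mxvec_index i j) (svd_right S3)) ^+ 2) in
  exists D E F : tensor R p1 p2 p3, [/\
    forall h, has_tucker_rank r1 r2 r3
      (fun a b c => T a b c + h * (D a b c + h * (E a b c + h * F a b c))),
    D i j k = g & tdot D D = g].
Proof.
move=> rT g.
have [A1 [w1 [y1 [A1A1 D1 wT1 [w1i w1w1] [y1i y1y1]]]]] :=
  tangent_mode1 S1 i j k.
have [A2 [w2 [y2 [A2A2 D2 wT2 [w2i w2w2] [y2i y2y2]]]]] :=
  @tangent_mode1 _ _ _ _ (rot T) S2 j k i.
have [A3 [w3 [y3 [A3A3 D3 wT3 [w3i w3w3] [y3i y3y3]]]]] :=
  @tangent_mode1 _ _ _ _ (rot (rot T)) S3 k i j.
have [E [F curve]] := multiplicative_curve T A1 A2 A3.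
set D := tadd _ _ in curve; exists D, E, F; split.
- move=> h; rewrite -curve.
  apply: tucker_rank_mode3; first exact: unitmx_1D_nilp.
  apply: tucker_rank_mode2; first exact: unitmx_1D_nilp.
  by apply: tucker_rank_mode1; first exact: unitmx_1D_nilp.
- rewrite /D /tadd D1 [X in _ + (X + _)]D2 [X in _ + (_ + X)]D3.
  by rewrite w1i w2i w3i y1i y2i y3i.
- (* Each pair of modes is, after a rotation, the pair of the first and the
     second mode. *)
  have D12 := tdot_mode1_mode2 A2 D1 wT1.
  have D23 := tdot_mode1_mode2 A3 D2 wT2.
  have D31 := tdot_mode1_mode2 A1 D3 wT3.
  have {}D23 : tdot (mode2_prod T A2) (mode3_prod T A3) = 0.
    by rewrite -tdot_rot.
  have {}D31 : tdot (mode3_prod T A3) (mode1_prod T A1) = 0.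
    by rewrite -tdot_rot -tdot_rot.
  rewrite /D !(tdotDl, tdotDr) (tdotC (mode2_prod T A2) (mode1_prod T A1)) D12.
  rewrite (tdotC (mode1_prod T A1) (mode3_prod T A3)) D31 D23.
  rewrite (tdotC (mode3_prod T A3) (mode2_prod T A2)) D23 !addr0 !add0r.
  congr (_ + (_ + _)).
  + by rewrite (tdot_outer D1) w1w1 y1y1.
  + by rewrite -tdot_rot (tdot_outer D2) w2w2 y2y2.
  + by rewrite -tdot_rot -tdot_rot (tdot_outer D3) w3w3 y3y3.
Qed.
End tangent.

(** * The information bound along a curve *)

Section gaussian_information_bound.
Local Open Scope ereal_scope.
Context (R : realType) (I : finType) d (Omega : measurableType d).
Variables (P : probability Omega R) (X : I -> {RV P >-> R}) (s : I -> R).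
Hypothesis s_neq0 : forall i, s i != 0%R.
Hypothesis law_X : forall i A, measurable A ->
  distribution P (X i) A = normal_prob 0 (s i) A.
Hypothesis indep_X : mutually_independent X.
Variable f : samples R I -> R.
Hypothesis mf : measurable_fun setT f.

Let fX (w : Omega) : R := f (X^~ w).
Let fXc (c : I -> R) (w : Omega) : R := f (fun i => X i w + c i)%R.

Lemma chapman_robbins_gaussian c (m m' t : R) :
  'E_P[fX] = m%:E -> 'E_P[fXc c] = m'%:E ->
  (2 * t * (m' - m))%:E <=
  'V_P[fX] + (t ^+ 2 * (expR (\sum_i (c i / s i) ^+ 2) - 1))%:E.
Proof.
move=> EfX EfXc.
have -> : 'V_P[fX] = \int[P]_w ((fX w - m) ^+ 2)%:E.
  rewrite /variance covariance.unlock EfX expectation.unlock /=.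
  by apply: eq_integral => w _; rewrite expr2.
rewrite expectation.unlock in EfX EfXc.
apply: chapman_robbins (EfX) _ (integral_lr s_neq0 law_X indep_X c)
  (integral_lr_sqr s_neq0 law_X indep_X c).
- exact: measurableT_comp mf (measurable_joint X).
- exact: measurable_lr.
- by rewrite -(cameron_martin s_neq0 law_X indep_X c mf).
Qed.

(** The Chapman-Robbins inequality at [t / h], where the exponential is
    controlled by [exp x - 1 <= x exp x], gives for [h <> 0] a bound that is
    continuous in [h]; the lemma is its limit along [h = 1 / (n + 1)]. *)
Lemma cramer_rao_curve (D E F : I -> R) (m : R) i0 (t : R) :
  (forall h : R, 'E_P[fXc (fun i => h * (D i + h * (E i + h * F i)))%R] =
    (m + h * (D i0 + h * (E i0 + h * F i0)))%:E) ->
  (2 * t * D i0 - t ^+ 2 * \sum_i (D i / s i) ^+ 2)%:E <= 'V_P[fX].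
Proof.
move=> Ef.
have EfX : 'E_P[fX] = m%:E.
  rewrite -[m]addr0 -[in RHS](mul0r (D i0 + 0 * (E i0 + 0 * F i0))%R) -Ef.
  congr expectation; apply/funext => w.
  by congr f; apply/funext => i; rewrite mul0r addr0.
have V0 : 0 <= 'V_P[fX] := variance_ge0 P fX.
have [->|Vfin] := eqVneq 'V_P[fX] +oo; first by rewrite leey.
have {Vfin} : 'V_P[fX] \is a fin_num by rewrite ge0_fin_numE// ltey.
move=> /fineK; set v := fine _ => Vv; rewrite -Vv lee_fin.
pose c h i := (D i + h * (E i + h * F i))%R.
pose Q h := (\sum_i (c h i / s i) ^+ 2)%R.
have bound h : h != 0%R ->
    (2 * t * c h i0 - t ^+ 2 * Q h * expR (h ^+ 2 * Q h) <= v)%R.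
  move=> h0; have := chapman_robbins_gaussian (t / h) EfX (Ef h).
  rewrite -Vv lee_fin addrAC subrr add0r -/(c h i0).
  have -> : (\sum_i (h * c h i / s i) ^+ 2 = h ^+ 2 * Q h)%R.
    by rewrite mulr_sumr; apply: eq_bigr => i _; rewrite -mulrA exprMn.
  have -> : (2 * (t / h) * (h * c h i0) = 2 * t * c h i0)%R by field.
  set x := (h ^+ 2 * Q h)%R => le1.
  have xE : (expR x - 1 <= x * expR x)%R.
    have := expR_ge1Dx (- x); rewrite expRN => le2.
    have := ler_wpM2r (expR_ge0 x) le2; rewrite mulVf ?gt_eqF ?expR_gt0//.
    lra.
  have := ler_wpM2l (sqr_ge0 (t / h)) xE.
  have -> : ((t / h) ^+ 2 * (x * expR x) = t ^+ 2 * Q h * expR x)%R.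
    by rewrite /x; field.
  lra.
have h_cvg : @harmonic R @ \oo --> 0%R by exact: cvg_harmonic.
have c_cvg i : c (harmonic n) i @[n --> \oo] --> D i.
  rewrite -[X in _ --> X]addr0 -[X in _ --> (_ + X)%R](mul0r (E i + 0 * F i)%R).
  by apply: cvgD; [exact: cvg_cst|apply: cvgM => //; apply: cvgD;
    [exact: cvg_cst|apply: cvgM => //; exact: cvg_cst]].
have Q_cvg : Q (harmonic n) @[n --> \oo] --> (\sum_i (D i / s i) ^+ 2)%R.
  apply: cvg_big => [|i _]; first exact: add_continuous.
  by apply: cvgM; apply: cvgM => //; exact: cvg_cst.
have x_cvg : (harmonic n ^+ 2 * Q (harmonic n))%R @[n --> \oo] --> (0 : R)%R.
  rewrite -[X in _ --> X](mul0r (\sum_i (D i / s i) ^+ 2)%R).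
  apply: cvgM => //; rewrite -[X in _ --> X](mul0r (0 : R)%R).
  by under eq_fun do rewrite expr2; exact: cvgM.
have e_cvg : expR (harmonic n ^+ 2 * Q (harmonic n)) @[n --> \oo] --> (1 : R)%R.
  rewrite -expR0; exact: continuous_cvg (@continuous_expR R _) x_cvg.
have lhs_cvg : (2 * t * c (harmonic n) i0 - t ^+ 2 * Q (harmonic n) *
    expR (harmonic n ^+ 2 * Q (harmonic n)))%R @[n --> \oo] -->
    (2 * t * D i0 - t ^+ 2 * (\sum_i (D i / s i) ^+ 2) * 1)%R.
  apply: cvgB; first by apply: cvgM => //; exact: cvg_cst.
  by apply: cvgM => //; apply: cvgM => //; exact: cvg_cst.
rewrite mulr1 in lhs_cvg.
apply: (cvgr_to_le lhs_cvg); apply: nearW => n; apply: bound.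
by rewrite gt_eqF// harmonic_gt0.
Qed.

End gaussian_information_bound.

Section tensor_bound.
Context (d : measure_display) (Omega : measurableType d) (R : realType).
Variables (P : probability Omega R) (p1 p2 p3 r1 r2 r3 : nat).
Variable sd : tensor R p1 p2 p3.
Variable Z : 'I_p1 -> 'I_p2 -> 'I_p3 -> {RV P >-> R}.
Implicit Types (T D E F : tensor R p1 p2 p3).

Notation index := ('I_p1 * 'I_p2 * 'I_p3)%type.

(** The sigma-algebra in the definition of estimators lives on curried tensors;
    the one used so far lives on families indexed by triples. *)
Lemma measurable_estimator delta T : estimator delta ->
  measurable_fun setT
    (fun x : samples R index => delta (fun a b c => T a b c + x (a, b, c))).
Proof.
move=> mdelta _ B mB; rewrite setTI.
pose tensors := g_sigma_algebraType (@entry_cylinders R p1 p2 p3).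
pose psi (x : samples R index) : tensors := fun a b c => T a b c + x (a, b, c).
have mpsi : measurable_fun setT psi.
  apply: (measurability
    (@entry_cylinders R p1 p2 p3 : set (set tensors))) => //.
  move=> _ [_ [a [b [c [C [mC ->]]]]] <-].
  have mcoord : measurable_fun setT
      (fun x : samples R index => T a b c + x (a, b, c)).
    by apply: measurable_funD => //; exact: measurable_samples_coord.
  by have := mcoord measurableT C mC.
by have := mpsi measurableT _ (mdelta B mB); rewrite setTI.
Qed.

(** At [t = smin^2] the information [sum (D / sd)^2] contributes at most
    [smin^2 g], half of the linear term [2 smin^2 g]. *)
Lemma cramer_rao_tensor delta T D E F i j k (smin g : R) :
  0 < smin -> (forall a b c, smin <= sd a b c) -> gaussian_noise sd Z ->
  estimator delta -> unbiased r1 r2 r3 Z i j k delta ->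
  (forall h, has_tucker_rank r1 r2 r3
    (fun a b c => T a b c + h * (D a b c + h * (E a b c + h * F a b c)))) ->
  D i j k = g -> tdot D D = g ->
  ((smin ^+ 2 * g)%:E <= 'V_P[fun w => delta (observed Z T w)])%E.
Proof.
move=> smin0 le_smin [law indep] mdelta unb curve Dg DDg.
have sd0 a b c : 0 < sd a b c by exact: lt_le_trans (le_smin a b c).
pose X (t : index) := Z t.1.1 t.1.2 t.2.
pose s (t : index) := sd t.1.1 t.1.2 t.2.
have s_neq0 t : s t != 0 by rewrite gt_eqF//; exact: sd0.
have law_X t A : measurable A -> distribution P (X t) A = normal_prob 0 (s t) A.
  exact: law.
have curve_mean (h : R) : ('E_P[fun w => delta (fun a b c => T a b c +
    (Z a b c w + h * (D a b c + h * (E a b c + h * F a b c))))%R] =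
    (T i j k + h * (D i j k + h * (E i j k + h * F i j k)))%:E)%E.
  rewrite -(unb _ (curve h)); congr expectation; apply/funext => w.
  congr delta; do 3 (apply/funext => ?).
  by rewrite /observed addrCA addrC addrAC.
apply: le_trans (cramer_rao_curve s_neq0 law_X indep
  (measurable_estimator T mdelta)
  (D := fun t => D t.1.1 t.1.2 t.2) (E := fun t => E t.1.1 t.1.2 t.2)
  (F := fun t => F t.1.1 t.1.2 t.2) (m := T i j k) (i0 := (i, j, k))
  (smin ^+ 2) curve_mean).
rewrite lee_fin /= Dg.
suff : smin ^+ 2 * \sum_(t : index) (D t.1.1 t.1.2 t.2 / s t) ^+ 2 <= g.
  by move=> /(ler_wpM2l (sqr_ge0 smin)); lra.
rewrite mulr_sumr -DDg /tdot pair_bigA pair_bigA /=; apply: ler_sum => t _.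
have s_gt0 : 0 < s t by exact: sd0.
rewrite -expr2 exprMn mulrCA ler_piMr ?sqr_ge0// exprVn.
rewrite ler_pdivrMr ?exprn_gt0// mul1r.
by rewrite lerXn2r ?nnegrE ?(ltW smin0) ?(ltW s_gt0)//; exact: le_smin.
Qed.

Lemma signal_bound (S : signal R p1 p2 p3 r1 r2 r3) delta i j k (smin eps : R) :
  0 < smin -> (forall a b c, smin <= sd a b c) -> gaussian_noise sd Z ->
  estimator delta -> unbiased r1 r2 r3 Z i j k delta ->
  norm2 (row i (svd_left (sig_svd1 S))) ^+ 2 <= eps ->
  norm2 (row j (svd_left (sig_svd2 S))) ^+ 2 <= eps ->
  norm2 (row k (svd_left (sig_svd3 S))) ^+ 2 <= eps ->
  (((1 - eps) * smin ^+ 2 *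
      (norm2 (row (mxvec_index j k) (sig_V1 S)) ^+ 2 +
       norm2 (row (mxvec_index k i) (sig_V2 S)) ^+ 2 +
       norm2 (row (mxvec_index i j) (sig_V3 S)) ^+ 2))%:E
     <= 'V_P[fun w => delta (observed Z S w)])%E.
Proof.
move=> smin0 le_smin noise mdelta unb u1 u2 u3.
have [D [E [F [curve Dg DDg]]]] :=
  tangent_curve (sig_svd1 S) (sig_svd2 S) (sig_svd3 S) i j k (sig_rank S).
apply: le_trans (cramer_rao_tensor smin0 le_smin noise mdelta unb curve Dg DDg).
rewrite lee_fin (mulrC (1 - eps)) -mulrA ler_wpM2l ?sqr_ge0// addrA !mulrDr.
by rewrite !lerD// ler_wpM2r ?sqr_ge0// lerD2l lerN2.
Qed.

End tensor_bound.

(** * Condition number, leverages and asymptotics *)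

Section condition_number.
Context (R : realType).

Lemma norm2_ge0 m n (A : 'M[R]_(m, n)) : 0 <= norm2 A.
Proof. exact: sqrtr_ge0. Qed.

Lemma norm_entry_le_norm2 n (x : 'cV[R]_n) j : `|x j 0| <= norm2 x.
Proof.
rewrite -(ler_pXn2r (n := 2))// ?nnegrE ?norm2_ge0// norm2_sqr.
rewrite real_normK ?num_real//.
rewrite (bigD1 j)//= big_ord1 lerDl sumr_ge0// => i _.
by rewrite big_ord1 sqr_ge0.
Qed.

(** The supremum defining the spectral norm bounds its members only once the set
    is known to be bounded; bounding each row by the sum of the absolute values
    of its entries is enough for that. *)
Lemma norm2_mul_le_spectral_norm m n (A : 'M[R]_(m, n)) (x : 'cV[R]_n) :
  norm2 x <= 1 -> norm2 (A *m x) <= spectral_norm A.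
Proof.
move=> x1; apply: ub_le_sup; last by exists x.
exists (Num.sqrt (\sum_i (\sum_j `|A i j|) ^+ 2)) => _ [y /= y1 <-].
rewrite ler_sqrt ?sumr_ge0// => [|i _]; last exact: sqr_ge0.
apply: ler_sum => i _; rewrite big_ord1 mxE -real_normK ?num_real//.
rewrite lerXn2r ?nnegrE ?sumr_ge0// (le_trans (ler_norm_sum _ _ _))//.
apply: ler_sum => j _; rewrite normrM ler_piMr//.
exact: le_trans (norm_entry_le_norm2 _ _) y1.
Qed.

Lemma last_singular_valueE m n (M : 'M[R]_(m, n)) r (S : rank_svd M r.+1) :
  last_singular_value S = svd_values S 0 ord_max.
Proof.
rewrite /last_singular_value -nth_last size_map size_enum_ord.
rewrite (nth_map ord0) ?size_enum_ord//; congr (svd_values S 0 _).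
by apply: val_inj; rewrite /= nth_enum_ord.
Qed.

Lemma last_singular_value_gt0 m n (M : 'M[R]_(m, n)) r (S : rank_svd M r) :
  (0 < r)%N -> 0 < last_singular_value S.
Proof.
by case: r S => // r S _; rewrite last_singular_valueE svd_values_gt0.
Qed.

(** The last right singular vector is a unit vector, mapped to a vector whose
    norm is the last singular value. *)
Lemma last_singular_value_le m n (M : 'M[R]_(m, n)) r (S : rank_svd M r) :
  (0 < r)%N -> last_singular_value S <= spectral_norm M.
Proof.
case: r S => // r S _; rewrite last_singular_valueE.
set l := svd_values S 0 _.
have unit_col k (U : 'M[R]_(k, r.+1)) (a : R) : U^T *m U = 1%:M ->
    norm2 (a *: col ord_max U) ^+ 2 = a ^+ 2.
  move=> /matrixP/(_ ord_max ord_max); rewrite !mxE eqxx mulr1n => UU.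
  rewrite norm2_sqr -[RHS]mulr1 -UU mulr_sumr; apply: eq_bigr => i _.
  by rewrite big_ord1 !mxE; ring.
have l_ge0 : 0 <= l by rewrite ltW// svd_values_gt0.
pose x := 1 *: col ord_max (svd_right S).
have x1 : norm2 x <= 1.
  by rewrite -(ler_pXn2r (n := 2))// ?nnegrE ?norm2_ge0// unit_col// svd_rightP.
have -> : l = norm2 (M *m x).
  apply/eqP; rewrite -(eqrXn2 (n := 2))// ?norm2_ge0//; apply/eqP.
  rewrite -(unit_col _ _ l (svd_leftP S)) /x scale1r; congr (norm2 _ ^+ 2).
  rewrite {2}(svdE S) -!mulmxA (colE _ (svd_right S)) (mulmxA _^T) svd_rightP.
  rewrite mul1mx -colE; apply/matrixP => i c.
  rewrite !mxE (bigD1 ord_max)//= big1 ?addr0.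
    by rewrite !mxE eqxx mulr1n mulrC.
  by move=> a /negbTE am; rewrite !mxE am mulr0n mulr0.
exact: norm2_mul_le_spectral_norm.
Qed.

Lemma condition_number_ge1 p1 p2 p3 r1 r2 r3 (S : signal R p1 p2 p3 r1 r2 r3) :
  (0 < r1)%N -> 1 <= condition_number S.
Proof.
move=> r1_gt0; rewrite /condition_number le_max; apply/orP; left.
by rewrite ler_pdivlMr ?last_singular_value_gt0// mul1r last_singular_value_le.
Qed.

Lemma leverage_le (p r : nat) (U : 'M[R]_(p, r)) (mu : R) i : (0 < r)%N ->
  Num.sqrt (p%:R / r%:R) * norm2oo U <= mu ->
  norm2 (row i U) ^+ 2 <= mu ^+ 2 * (r%:R / p%:R).
Proof.
move=> r0 le_mu; have p0 : (0 < p)%N by case: p i {le_mu U} => // -[].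
have pr0 : 0 < p%:R / r%:R :> R by rewrite divr_gt0 ?ltr0n.
rewrite -[r%:R / _]invf_div ler_pdivlMr// mulrC -(sqr_sqrtr (ltW pr0)) -exprMn.
have row_le : norm2 (row i U) <= norm2oo U.
  exact: (le_bigmax _ (fun i => norm2 (row i U))).
have {}le_mu := le_trans (ler_wpM2l (sqrtr_ge0 _) row_le) le_mu.
have ge0 : 0 <= Num.sqrt (p%:R / r%:R) * norm2 (row i U).
  by rewrite mulr_ge0 ?sqrtr_ge0 ?norm2_ge0.
by rewrite lerXn2r ?nnegrE// (le_trans ge0 le_mu).
Qed.

(** Positivity of [p' n] matters because of division by zero: it forces [p n] to
    be positive too, since [p' n] is at most a multiple of [p n]. *)
Lemma asymp_ratio (p p' r r' : nat -> nat) :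
  asymp (fun n => (p' n)%:R : R) (fun n => (p n)%:R) ->
  asymp (fun n => (r' n)%:R : R) (fun n => (r n)%:R) ->
  exists2 K : R, 0 < K & forall n, (0 < p' n)%N ->
    (r' n)%:R / (p' n)%:R <= K * ((r n)%:R / (p n)%:R) :> R.
Proof.
move=> [[C1 C10 p'p] [C2 C20 pp']] [[C3 C30 r'r] _].
exists (C3 * C2) => [|n p'0]; first exact: mulr_gt0.
have p'0R : 0 < (p' n)%:R :> R by rewrite ltr0n.
have p0R : 0 < (p n)%:R :> R.
  by have := lt_le_trans p'0R (p'p n); rewrite pmulr_rgt0.
rewrite ler_pdivrMr//; apply: le_trans (r'r n) _.
have -> : C3 * C2 * ((r n)%:R / (p n)%:R) * (p' n)%:R =
    C3 * (r n)%:R * (C2 * (p' n)%:R / (p n)%:R) by ring.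
by rewrite ler_peMr ?mulr_ge0 ?(ltW C30)// ler_pdivlMr// mul1r.
Qed.
End condition_number.

Theorem theorem8 (R : realType)
  (p p1 p2 p3 r r1 r2 r3 : nat -> nat)
  (S : forall n, signal R (p1 n) (p2 n) (p3 n) (r1 n) (r2 n) (r3 n))
  (sigma sigma_min : nat -> R)
  (sd : forall n, tensor R (p1 n) (p2 n) (p3 n))
  (d : nat -> measure_display)
  (Omega : forall n, measurableType (d n))
  (P : forall n, probability (Omega n) R)
  (Z : forall n, 'I_(p1 n) -> 'I_(p2 n) -> 'I_(p3 n) -> {RV (P n) >-> R}) :
  p @ \oo --> \oo ->
  asymp (fun n => (p1 n)%:R : R) (fun n => (p n)%:R) ->
  asymp (fun n => (p2 n)%:R : R) (fun n => (p n)%:R) ->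
  asymp (fun n => (p3 n)%:R : R) (fun n => (p n)%:R) ->
  (forall n, [/\ 0 < r1 n, 0 < r2 n & 0 < r3 n]%N) ->
  asymp (fun n => (r1 n)%:R : R) (fun n => (r n)%:R) ->
  asymp (fun n => (r2 n)%:R : R) (fun n => (r n)%:R) ->
  asymp (fun n => (r3 n)%:R : R) (fun n => (r n)%:R) ->
  (forall n, 0 < sigma_min n) ->
  (forall n i j k, sigma_min n <= sd n i j k <= sigma n) ->
  lesssim sigma sigma_min ->
  (forall n, gaussian_noise (sd n) (Z n)) ->
  much_less
    (fun n => condition_number (S n) ^+ 2 * incoherence (S n) *
              Num.sqrt ((r n)%:R / (p n)%:R))
    (fun=> 1) ->
  exists2 eps : nat -> R, eps @ \oo --> (0 : R) &
    forall n (i : 'I_(p1 n)) (j : 'I_(p2 n)) (k : 'I_(p3 n))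
      (delta : tensor R (p1 n) (p2 n) (p3 n) -> R),
    estimator delta ->
    unbiased (r1 n) (r2 n) (r3 n) (Z n) i j k delta ->
    (((1 - eps n) * sigma_min n ^+ 2 *
      (norm2 (row (mxvec_index j k) (sig_V1 (S n))) ^+ 2 +
       norm2 (row (mxvec_index k i) (sig_V2 (S n))) ^+ 2 +
       norm2 (row (mxvec_index i j) (sig_V3 (S n))) ^+ 2))%:E
     <= 'V_(P n)[fun w => delta (observed (Z n) (S n) w)])%E.
Proof.
move=> _ p1p p2p p3p r_gt0 r1r r2r r3r smin_gt0 sd_bounds _ noise small.
have [K1 K1_gt0 K1P] := asymp_ratio p1p r1r.
have [K2 K2_gt0 K2P] := asymp_ratio p2p r2r.
have [K3 K3_gt0 K3P] := asymp_ratio p3p r3r.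
pose b n := condition_number (S n) ^+ 2 * incoherence (S n) *
  Num.sqrt ((r n)%:R / (p n)%:R).
have b_cvg : b @ \oo --> (0 : R).
  by move: small; rewrite /much_less; under eq_fun do rewrite divr1.
pose K := K1 + K2 + K3.
exists (fun n => K * b n ^+ 2).
  suff : (fun n => K * b n ^+ 2) @ \oo --> (K * (0 * 0) : R) by rewrite !mulr0.
  apply: cvgM; first exact: cvg_cst.
  by under eq_fun do rewrite expr2; exact: cvgM.
move=> n i j k delta mdelta unb.
have [r1_gt0 r2_gt0 r3_gt0] := r_gt0 n.
have leverage_le_eps (q s : nat) (U : 'M[R]_(q, s)) (a : 'I_q) (k' : R) :
    (0 < s)%N -> k' <= K ->
    s%:R / q%:R <= k' * ((r n)%:R / (p n)%:R) ->
    Num.sqrt (q%:R / s%:R) * norm2oo U <= incoherence (S n) ->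
    norm2 (row a U) ^+ 2 <= K * b n ^+ 2.
  move=> s_gt0 k'K sq le_inc; apply: le_trans (leverage_le a s_gt0 le_inc) _.
  apply: le_trans (ler_wpM2l (sqr_ge0 _) sq) _.
  have rp_ge0 : 0 <= (r n)%:R / (p n)%:R :> R by rewrite divr_ge0.
  rewrite /b exprMn sqr_sqrtr// exprMn mulrCA.
  have inc_ge0 : 0 <= incoherence (S n) ^+ 2 * ((r n)%:R / (p n)%:R).
    by rewrite mulr_ge0// sqr_ge0.
  have K_ge0 : 0 <= K by rewrite !addr_ge0// ltW.
  apply: le_trans (ler_wpM2r inc_ge0 k'K) _.
  (* The power of the condition number is the only factor left to discard. *)
  rewrite ler_wpM2l// -mulrA ler_peMl// -exprM exprn_ege1//.
  exact: condition_number_ge1.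
have i_gt0 (q : nat) (a : 'I_q) : (0 < q)%N by case: q a => // -[].
apply: signal_bound (smin_gt0 n) _ (noise n) mdelta unb _ _ _.
- by move=> a c e; have /andP[] := sd_bounds n a c e.
- apply: leverage_le_eps r1_gt0 _ (K1P n (i_gt0 _ i)) _.
    by rewrite /K; lra.
  by rewrite /incoherence !le_max lexx.
- apply: leverage_le_eps r2_gt0 _ (K2P n (i_gt0 _ j)) _.
    by rewrite /K; lra.
  by rewrite /incoherence !le_max lexx !orbT.
- apply: leverage_le_eps r3_gt0 _ (K3P n (i_gt0 _ k)) _.
    by rewrite /K; lra.
  by rewrite /incoherence !le_max lexx !orbT.
Qed.
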